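(* Let $(G,f)$ be an $n$-ary group and let $\mu:G\to[0,1]$ be a fuzzy subset of $G$. Then $\mu$ is a fuzzy $n$-ary subgroup of $(G,f)$ if and only if for all $i=1,2,\dots,n$ and all $x_1,\dots,x_n\in G$ the following two conditions hold: (i) $\mu(f(x_1,\dots,x_n))\ge\min\{\mu(x_1),\dots,\mu(x_n)\}$; (ii) $\mu(x_i)\ge\min\{\mu(x_1),\dots,\mu(x_{i-1}),\mu(f(x_1,\dots,x_n)),\mu(x_{i+1}),\dots,\mu(x_n)\}$.
   Context: Let $n\ge 2$. An $n$-ary group $(G,f)$ is a nonempty set $G$ with an operation $f:G^n\to G$ such that (a) $f$ is associative: for all $1\le i<j\le n$ and all $x_1,\dots,x_{2n-1}\in G$, $f(x_1,\dots,x_{i-1},f(x_i,\dots,x_{n+i-1}),x_{n+i},\dots,x_{2n-1})=f(x_1,\dots,x_{j-1},f(x_j,\dots,x_{n+j-1}),x_{n+j},\dots,x_{2n-1})$; and (b) for every $i\in\{1,\dots,n\}$ and all $x_0,x_1,\dots,x_n\in G$ there is a unique $z\in G$ with $f(x_1,\dots,x_{i-1},z,x_{i+1},\dots,x_n)=x_0$. For $n=2$ this is a usual group. The skew element $\overline{x}$ of $x\in G$ is the unique element with $f(x,\dots,x,\overline{x})=x$ ($x$ repeated $n-1$ times). A fuzzy subset of $G$ is a function $\mu:G\to[0,1]$. For $n\ge3$, a fuzzy subset $\mu$ is a fuzzy $n$-ary subgroup of $(G,f)$ if $\mu(f(x_1,\dots,x_n))\ge\min\{\mu(x_1),\dots,\mu(x_n)\}$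 for all $x_1,\dots,x_n\in G$ and $\mu(\overline{x})\ge\mu(x)$ for all $x\in G$. For $n=2$, with $(G,f)$ regarded as a usual group with product $xy=f(x,y)$, a fuzzy ($2$-ary) subgroup means a fuzzy subgroup: $\mu(xy)\ge\min\{\mu(x),\mu(y)\}$ and $\mu(x^{-1})\ge\mu(x)$ for all $x,y\in G$. *)

(* Defs.v *)
From mathcomp Require Import all_boot all_order all_algebra.
From mathcomp Require Import boolp reals.
From mathcomp Require Import zify.

Set Implicit Arguments.
Unset Strict Implicit.
Unset Printing Implicit Defensive.

Import Order.TTheory GRing.Theory Num.Theory.

(** Indices run over ['I_n] = {0, ..., n-1}; the operation f : G^n -> G takes
    an n-tuple. *)

Section Nary.
Variables (G : Type) (n : nat).
Implicit Types (f : n.-tuple G -> G) (x : n.-tuple G) (i : 'I_n).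

(** (x_1, ..., x_{i-1}, z, x_{i+1}, ..., x_n) *)
Definition replace i x (z : G) : n.-tuple G :=
  [tuple if j == i then z else tnth x j | j < n].

Lemma inner_size (s : (2 * n - 1).-tuple G) i : size (take n (drop i s)) == n.
Proof.
by rewrite size_takel // size_drop size_tuple; have := ltn_ord i; lia.
Qed.

(** (x_i, ..., x_{n+i-1}) *)
Definition inner (s : (2 * n - 1).-tuple G) i : n.-tuple G :=
  Tuple (inner_size s i).

Lemma outer_size f (s : (2 * n - 1).-tuple G) i :
  size (take i s ++ f (inner s i) :: drop (i + n) s) == n.
Proof.
have lti := ltn_ord i.
have le_i : i <= size s by rewrite size_tuple; lia.
by rewrite size_cat /= size_takel // size_drop size_tuple; lia.
Qed.

(** (x_1, ..., x_{i-1}, f(x_i, ..., x_{n+i-1}), x_{n+i}, ..., x_{2n-1}) *)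
Definition outer f (s : (2 * n - 1).-tuple G) i : n.-tuple G :=
  Tuple (outer_size f s i).

Record nary_group f : Prop := NaryGroup {
  nary_arity : 1 < n;
  nary_nonempty : inhabited G;
  nary_assoc : forall i j : 'I_n, i < j ->
    forall s : (2 * n - 1).-tuple G, f (outer f s i) = f (outer f s j);
  nary_solve : forall i x (x0 : G), exists! z : G, f (replace i x z) = x0
}.

(** (x, ..., x, z) with x repeated n-1 times *)
Definition skew_tuple (x z : G) : n.-tuple G :=
  [tuple if j.+1 == n then z else x | j < n].

Lemma skew_exists f (Gf : nary_group f) (x : G) :
  exists! z : G, f (skew_tuple x z) = x.
Proof.
have ltn1 : n.-1 < n by move: (nary_arity Gf); lia.
have E z : skew_tuple x z = replace (Ordinal ltn1) [tuple x | _ < n] z.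
  apply: eq_from_tnth => j; rewrite !tnth_mktuple -val_eqE /=.
  by congr (if _ then _ else _); move: (nary_arity Gf); lia.
have [z [zP zU]] := nary_solve Gf (Ordinal ltn1) [tuple x | _ < n] x.
by exists z; split=> [|w]; rewrite E //; exact: zU.
Qed.

Definition skew f (Gf : nary_group f) (x : G) : G :=
  projT1 (cid (skew_exists Gf x)).

End Nary.

(** For n = 2, the identity and the inverses of the usual group (G, f). *)
Section Binary.
Variables (G : Type) (f : 2.-tuple G -> G) (Gf : nary_group f).

Local Notation "x ** y" := (f [tuple x; y]) (at level 40, left associativity).

Lemma binary_assoc x y z : x ** y ** z = x ** (y ** z).
Proof.
have := nary_assoc Gf (i := ord0) (j := ord_max) isT [tuple x; y; z].
have -> : outer f [tuple x; y; z] ord0 = [tuple x ** y; z].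
  apply: val_inj => /=; congr [:: f _; _]; exact: val_inj.
have -> // : outer f [tuple x; y; z] ord_max = [tuple x; y ** z].
apply: val_inj => /=; congr [:: _; f _]; exact: val_inj.
Qed.

Lemma binary_solve_l y x0 : exists z, z ** y = x0.
Proof.
have [z [zP _]] := nary_solve Gf ord0 [tuple y; y] x0.
exists z; rewrite -zP; congr f; apply: eq_from_tnth => j.
by rewrite tnth_mktuple; case: j => [[|[|]]].
Qed.

Lemma binary_solve_r x x0 : exists z, x ** z = x0.
Proof.
have [z [zP _]] := nary_solve Gf ord_max [tuple x; x] x0.
exists z; rewrite -zP; congr f; apply: eq_from_tnth => j.
by rewrite tnth_mktuple; case: j => [[|[|]]].
Qed.

Lemma binary_one_exists : exists e, forall y, e ** y = y /\ y ** e = y.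
Proof.
have [a] := nary_nonempty Gf.
have [e ae] := binary_solve_r a a; have [e' ea] := binary_solve_l a a.
have re y : y ** e = y.
  by have [b <-] := binary_solve_l a y; rewrite binary_assoc ae.
have le y : e' ** y = y.
  by have [b <-] := binary_solve_r a y; rewrite -binary_assoc ea.
have ee : e = e' by rewrite -(le e) re.
by exists e => y; split; [rewrite ee le | rewrite re].
Qed.

Definition binary_one : G := projT1 (cid binary_one_exists).

Lemma binary_inv_exists x :
  exists y, y ** x = binary_one /\ x ** y = binary_one.
Proof.
have oneP : forall y, binary_one ** y = y /\ y ** binary_one = y.
  by rewrite /binary_one; case: cid.
have [y yx] := binary_solve_l x binary_one.
have [z xz] := binary_solve_r x binary_one.
exists y; split=> //.
suff -> : y = z by [].
by rewrite -(proj2 (oneP y)) -xz -binary_assoc yx (proj1 (oneP z)).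
Qed.

Definition binary_inv (x : G) : G := projT1 (cid (binary_inv_exists x)).

End Binary.

Local Open Scope ring_scope.

Definition fuzzy_subset (R : realType) (G : Type) (mu : G -> R) : Prop :=
  forall x, 0 <= mu x <= 1.

(** min {mu(x_1), ..., mu(x_n)}; the default value 1 is neutral for the minimum
    on [0,1]. *)
Definition fuzzy_min (R : realType) (G : Type) (mu : G -> R) (n : nat)
    (x : n.-tuple G) : R :=
  \big[Num.min/1]_(j < n) mu (tnth x j).

Definition fuzzy_subgroup2 (R : realType) (G : Type) (mu : G -> R)
    (f : 2.-tuple G -> G) (Gf : nary_group f) : Prop :=
  (forall x y : G, Num.min (mu x) (mu y) <= mu (f [tuple x; y])) /\
  (forall x : G, mu x <= mu (binary_inv Gf x)).

Definition fuzzy_subgroup_skew (R : realType) (G : Type) (mu : G -> R)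
    (n : nat) (f : n.-tuple G -> G) (Gf : nary_group f) : Prop :=
  (forall x : n.-tuple G, fuzzy_min mu x <= mu (f x)) /\
  (forall x : G, mu x <= mu (skew Gf x)).

Definition fuzzy_nary_subgroup (R : realType) (G : Type) (mu : G -> R)
    (n : nat) : forall f : n.-tuple G -> G, nary_group f -> Prop :=
  match n with
  | 2%N => @fuzzy_subgroup2 R G mu
  | m => @fuzzy_subgroup_skew R G mu m
  end.

(* Main.v *)
Require Import Defs.
From mathcomp Require Import all_boot all_order all_algebra.
From mathcomp Require Import boolp reals.
From mathcomp Require Import zify.

Set Implicit Arguments.
Unset Strict Implicit.
Unset Printing Implicit Defensive.

Import Order.TTheory.

(** From the two inequalities to a fuzzy subgroup, read (ii) at the last
    position of f(x, ..., x, skew x) = x; for n = 2, read it in x e = x and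
    then in x x^-1 = e.

    Conversely, let t be the minimum on the right-hand side of (ii). The level
    set H = {y | t <= mu y} is closed under f and under skew elements (or
    inverses), contains f(x) and all the x_j with j <> i, and one has to show
    that it contains z = x_i. For n = 2 this is cancellation. For n >= 3 the
    skew elements provide, for every x in H, words u and v over H of length
    n-2 with f(u, x, y) = y = f(y, x, v) for all y. Hence, by associativity,
    f(u, f(x, s), w) = f(s, w) and f(w, f(s, x), v) = f(w, s): a letter of H
    can be dropped at one end of a word of value in H and an arbitrary letter
    w of H added at the other end, the value remaining in H ([shiftl],
    [shiftr]). Dropping all letters to the left of z, then all those to its
    right, yields f(p, z) in H for a word p over H of our choice, and p can be
    taken so that f(p, z) = z ([solve_closed]). *)

Lemma nseq_cat_cons T k (x : T) s : nseq k x ++ x :: s = x :: nseq k x ++ s.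
Proof. by elim: k => //= k ->. Qed.

(** * The operation of an n-ary group on words *)

Section Words.
Variables (G : Type) (n : nat) (f : n.-tuple G -> G) (Gf : nary_group f).
Variable x0 : G.

(** f as an operation on words, with the default value [x0] on the words whose
    length is not n. *)
Definition wordop (s : seq G) : G := oapp f x0 (insub s).
Local Notation F := wordop.

Lemma wordop_tuple (x : n.-tuple G) : F x = f x.
Proof. by rewrite /wordop valK. Qed.

Lemma wordop_size s (Hs : size s == n) : F s = f (Tuple Hs).
Proof. by rewrite -wordop_tuple. Qed.

Lemma replace_cat i (x : n.-tuple G) z :
  tval (replace i x z) = take i x ++ z :: drop i.+1 x.
Proof.
have lti := ltn_ord i.
apply: (@eq_from_nth _ x0) => [|k].
  by rewrite size_tuple size_cat /= size_takel ?size_drop size_tuple; lia.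
rewrite size_tuple => ltk.
rewrite -(tnth_nth x0 _ (Ordinal ltk)) tnth_mktuple -val_eqE /= nth_cat.
rewrite size_takel; last by rewrite size_tuple; lia.
case: ltngtP => [lt_ki|lt_ik|->]; last by rewrite subnn.
  by rewrite nth_take // (tnth_nth x0).
rewrite -[(k - i)%N]prednK ?subn_gt0 //= nth_drop (tnth_nth x0) /=.
by congr nth; lia.
Qed.

(** Associativity: two bracketings of one word of length 2n-1. *)
Lemma wordop_assoc a b c a' b' c' : size b = n -> size b' = n ->
    (size a + size c).+1 = n -> (size a' + size c').+1 = n ->
    a ++ b ++ c = a' ++ b' ++ c' ->
  F (a ++ F b :: c) = F (a' ++ F b' :: c').
Proof.
move=> sb sb' sac sac' E.
have szs : size (a ++ b ++ c) == (2 * n - 1)%N by rewrite !size_cat; lia.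
have outerE d e g (ltd : size d < n) : size e = n -> (size d + size g).+1 = n ->
    a ++ b ++ c = d ++ e ++ g ->
    F (d ++ F e :: g) = f (outer f (Tuple szs) (Ordinal ltd)).
  move=> se sdg Es; rewrite -wordop_tuple; congr F => /=.
  rewrite -(wordop_tuple (inner _ _)) /= Es.
  rewrite take_size_cat // drop_size_cat // take_size_cat // catA.
  by rewrite drop_size_cat // size_cat se.
have lta : size a < n by lia.
have lta' : size a' < n by lia.
rewrite (outerE a b c lta) // (outerE a' b' c' lta') //.
case: (ltngtP (size a) (size a')) => [lt_aa|lt_aa|eq_aa].
- exact: (nary_assoc Gf).
- by apply/esym; exact: (nary_assoc Gf).
- by congr (f (outer _ _ _)); exact: val_inj.
Qed.

Lemma wordop_solve a c y : (size a + size c).+1 = n ->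
  exists! z, F (a ++ z :: c) = y.
Proof.
move=> sac.
have szs : size (a ++ x0 :: c) == n by rewrite size_cat /=; lia.
have lta : size a < n by lia.
have E z : F (a ++ z :: c) = f (replace (Ordinal lta) (Tuple szs) z).
  rewrite -wordop_tuple replace_cat /= take_size_cat //.
  by rewrite -add1n -drop_drop drop_size_cat // drop1.
have [z [zP zU]] := nary_solve Gf (Ordinal lta) (Tuple szs) y.
by exists z; split=> [|w]; rewrite E //; exact: zU.
Qed.

(** Cancellation at any position. *)
Lemma wordop_inj a c z z' : (size a + size c).+1 = n ->
  F (a ++ z :: c) = F (a ++ z' :: c) -> z = z'.
Proof.
move=> sac E; have [w [_ wU]] := wordop_solve (F (a ++ z' :: c)) sac.
by rewrite -(wU z E) -(wU z' erefl).
Qed.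

(** * Neutral words built from skew elements *)

Local Notation xbar := (Defs.skew Gf).

Lemma wordop_skew (x : G) : F (nseq n.-1 x ++ [:: xbar x]) = x.
Proof.
have n_gt1 := nary_arity Gf.
rewrite /Defs.skew; case: cid => z /= [zP _].
rewrite -[RHS]zP -wordop_tuple; congr F.
apply: (@eq_from_nth _ x0) => [|k].
  by rewrite size_tuple size_cat size_nseq /=; lia.
rewrite size_cat size_nseq /= => ltk.
have ltkn : k < n by lia.
rewrite -(tnth_nth x0 (skew_tuple n x z) (Ordinal ltkn)) tnth_mktuple /=.
rewrite nth_cat size_nseq nth_nseq; case: ltnP => h.
  by case: eqP => //; lia.
have -> : k = n.-1 by lia.
by rewrite subnn prednK ?eqxx //; lia.
Qed.

(** Write y = f(w, x, ..., x): the last x, the n-2 letters that follow and the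
    skew of x form a block of value x. *)
Lemma wordop_skew_r (x y : G) : F (y :: nseq n.-2 x ++ [:: xbar x]) = y.
Proof.
have n_gt1 := nary_arity Gf.
have [|w [<- _]] := @wordop_solve [::] (nseq n.-1 x) y.
  by rewrite size_nseq /=; lia.
have En : n.-1 = n.-2.+1 by lia.
rewrite (@wordop_assoc [::] _ _ (w :: nseq n.-2 x)
  (nseq n.-1 x ++ [:: xbar x]) [::]).
- by rewrite wordop_skew /= nseq_cat_cons cats0 En.
- by rewrite /= size_nseq; lia.
- by rewrite size_cat size_nseq /=; lia.
- by rewrite size_cat size_nseq /=; lia.
- by rewrite /= size_nseq /=; lia.
- rewrite /= cats0 !catA -!nseqD.
  by congr (_ :: nseq _ _ ++ _); lia.
Qed.

Lemma wordop_skew_head x : F (xbar x :: nseq n.-1 x) = x.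
Proof.
have n_gt1 := nary_arity Gf.
(* Both sides agree after left multiplication by the word x^(n-1). *)
apply: (@wordop_inj (nseq n.-1 x) [::]); first by rewrite size_nseq /=; lia.
rewrite (@wordop_assoc _ _ _ [::] (nseq n.-1 x ++ [:: xbar x]) (nseq n.-1 x)).
- by rewrite wordop_skew /= nseq_cat_cons cats0.
- by rewrite /= size_nseq; lia.
- by rewrite size_cat size_nseq /=; lia.
- by rewrite /= size_nseq; lia.
- by rewrite /= size_nseq; lia.
- by rewrite /= cats0 -catA.
Qed.

(** As for [wordop_skew_r], with y = f(x, ..., x, w) and
    [wordop_skew_head]. *)
Lemma wordop_skew_l x y : F (xbar x :: nseq n.-2 x ++ [:: y]) = y.
Proof.
have n_gt1 := nary_arity Gf.
have [|w [<- _]] := @wordop_solve (nseq n.-1 x) [::] y.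
  by rewrite size_nseq /=; lia.
have En : n.-1 = n.-2.+1 by lia.
rewrite -cat_cons (@wordop_assoc (xbar x :: nseq n.-2 x) _ [::] [::]
  (xbar x :: nseq n.-1 x) (nseq n.-2 x ++ [:: w])).
- by rewrite wordop_skew_head En.
- by rewrite size_cat size_nseq /=; lia.
- by rewrite /= size_nseq; lia.
- by rewrite /= size_nseq; lia.
- by rewrite size_cat size_nseq /=; lia.
- rewrite /= cats0 !catA -!nseqD.
  by congr (_ :: nseq _ _ ++ _); lia.
Qed.

(** * Subsets closed under the operation and under skew elements *)

Section Closed.
Hypothesis n_gt2 : (2 < n)%N.
Variable H : pred G.
Hypothesis H_op : forall s, size s = n -> all H s -> H (F s).
Hypothesis H_skew : forall x, H x -> H (xbar x).

(** A letter of [H] is dropped on the left and another one added on the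
    right. *)
Lemma shiftl x w s : size s = n.-1 -> H x -> H w ->
  H (F (x :: s)) -> H (F (rcons s w)).
Proof.
case: s => [|y s] ss Hx Hw; first by move: ss => /=; lia.
move=> Hs; rewrite /= in ss.
have En : n.-2 = (n - 3).+1 by lia.
pose u := xbar x :: nseq (n - 3) x.
have uE : F (u ++ [:: x; y]) = y.
  rewrite -[RHS](wordop_skew_l x) /u /=; congr (F (_ :: _)).
  by rewrite nseq_cat_cons En.
have -> : F (rcons (y :: s) w) = F (u ++ [:: F (x :: y :: s); w]).
  rewrite -{1}uE.
  rewrite (@wordop_assoc u _ [:: w] [::] (u ++ [:: x; y]) (rcons s w)) //.
  - by rewrite /=; lia.
  - by rewrite size_cat /= size_nseq; lia.
  - by rewrite /= size_nseq; lia.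
  - by rewrite /= size_rcons; lia.
  - by rewrite -cats1 -catA.
apply: H_op; first by rewrite size_cat /= size_nseq; lia.
by rewrite all_cat /= all_nseq Hx Hs Hw H_skew ?orbT.
Qed.

(** The mirror image of [shiftl]. *)
Lemma shiftr x w s : size s = n.-1 -> H x -> H w ->
  H (F (rcons s x)) -> H (F (w :: s)).
Proof.
case/lastP: s => [|s y] ss Hx Hw; first by move: ss => /=; lia.
move=> Hs; rewrite size_rcons in ss.
have En : n.-2 = (n - 3).+1 by lia.
pose v := nseq (n - 3) x ++ [:: xbar x].
have vE : F (y :: x :: v) = y.
  rewrite -[RHS](wordop_skew_r x) /v /=; congr (F (_ :: _)).
  by rewrite En.
have -> : F (w :: rcons s y) = F (w :: F (rcons (rcons s y) x) :: v).
  rewrite -[w :: F _ :: v]/([:: w] ++ F (rcons (rcons s y) x) :: v).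
  rewrite (@wordop_assoc [:: w] _ v (w :: s) (y :: x :: v) [::]).
  - by rewrite vE /= cats1.
  - by rewrite !size_rcons; lia.
  - by rewrite /= size_cat size_nseq /=; lia.
  - by rewrite /= size_cat size_nseq /=; lia.
  - by rewrite /=; lia.
  - by rewrite /= cats0 -!cats1 -!catA.
apply: H_op; first by rewrite /= size_cat size_nseq /=; lia.
by rewrite /= all_cat /= all_nseq Hx Hs Hw H_skew ?orbT.
Qed.

(** [shiftl] repeated: the letters s1 on the left of z are exchanged for
    arbitrary letters t of [H] on the far right. *)
Lemma shiftl_word s1 s2 t z : (size s1 + size s2).+1 = n ->
    size t = size s1 -> all H s1 -> all H t ->
  H (F (s1 ++ z :: s2)) -> H (F (z :: s2 ++ t)).
Proof.
elim: s1 s2 t => [|x s1 IH] s2 [|w t] //=; first by rewrite cats0.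
move=> sn [st] /andP[Hx Hs1] /andP[Hw Ht] Hs.
rewrite -cat_rcons; apply: IH => //; first by rewrite size_rcons; lia.
rewrite -rcons_cons -rcons_cat; apply: (@shiftl x) => //.
by rewrite size_cat /=; lia.
Qed.

(** The mirror image of [shiftl_word]. *)
Lemma shiftr_word s1 s2 t z : (size s1 + size s2).+1 = n ->
    size t = size s2 -> all H s2 -> all H t ->
  H (F (s1 ++ z :: s2)) -> H (F (t ++ s1 ++ [:: z])).
Proof.
elim/last_ind: s2 s1 t => [|s2 x IH] s1 t; first by move=> _ /size0nil ->.
case/lastP: t => [|t w]; rewrite !size_rcons ?all_rcons //.
move=> sn [st] /andP[Hx Hs2] /andP[Hw Ht] Hs.
rewrite cat_rcons -cat_cons; apply: IH => //=; first by lia.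
apply: (@shiftr x) => //; first by rewrite size_cat /=; lia.
by rewrite rcons_cat rcons_cons.
Qed.

(** The equations with parameters in [H] are solved in [H]. *)
Lemma solve_closed s1 s2 z : (size s1 + size s2).+1 = n ->
  all H s1 -> all H s2 -> H (F (s1 ++ z :: s2)) -> H z.
Proof.
move=> sn Hs1 Hs2 Hs.
(* The final word p with f(p, z) = z is built from any letter of [H]. *)
have [x Hx] : exists x, H x.
  case: s1 s2 Hs1 Hs2 sn {Hs} => [|x s1] [|y s2] /=; first by lia.
  - by move=> _ /andP[Hy _]; exists y.
  - by case/andP=> Hx; exists x.
  - by case/andP=> Hx; exists x.
rewrite -(wordop_skew_l x z) -cat_cons.
apply: (@shiftr_word [::] (s2 ++ s1)) => //=.
- by rewrite size_cat; lia.
- by rewrite size_nseq size_cat; lia.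
- by rewrite all_cat Hs1 Hs2.
- by rewrite all_nseq Hx H_skew ?orbT.
exact: (@shiftl_word s1).
Qed.

End Closed.
End Words.

(** * Fuzzy minima *)

Local Open Scope ring_scope.

Lemma le_fuzzy_min (R : realType) (G : Type) (mu : G -> R) n (x : n.-tuple G)
    (t : R) :
  t <= fuzzy_min mu x <-> t <= 1 /\ all (fun y => t <= mu y) x.
Proof.
rewrite /fuzzy_min; split.
  move=> tx; split; first exact: le_trans tx (bigmin_le_id _ _ _ _).
  apply/all_tnthP => j; exact: le_trans tx (bigmin_le_cond _ _ _).
case=> t1 /all_tnthP tx; apply: le_bigmin => // j _; exact: tx.
Qed.

Lemma fuzzy_min2 (R : realType) (G : Type) (mu : G -> R) a b :
  fuzzy_subset mu -> fuzzy_min mu [tuple a; b] = Num.min (mu a) (mu b).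
Proof.
move=> hmu; rewrite /fuzzy_min !big_ord_recl big_ord0 /= !(tnth_nth a) /=.
by have /andP[_ /min_idPl ->] := hmu b.
Qed.

(** * Identity and inverses of a binary group *)

Lemma binary_oneP (G : Type) (f : 2.-tuple G -> G) (Gf : nary_group f) y :
  f [tuple binary_one Gf; y] = y /\ f [tuple y; binary_one Gf] = y.
Proof. by rewrite /binary_one; case: cid. Qed.

Lemma binary_invP (G : Type) (f : 2.-tuple G -> G) (Gf : nary_group f) x :
  f [tuple binary_inv Gf x; x] = binary_one Gf /\
  f [tuple x; binary_inv Gf x] = binary_one Gf.
Proof. by rewrite /binary_inv; case: cid. Qed.

(** * The two directions *)

Section Directions.
Variables (R : realType) (G : Type) (mu : G -> R).
Hypothesis hmu : fuzzy_subset mu.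

(** The conditions (i) and (ii) for mu, at all positions and all tuples. *)
Definition nary_inequalities n (f : n.-tuple G -> G) : Prop :=
  forall (i : 'I_n) (x : n.-tuple G),
    fuzzy_min mu x <= mu (f x) /\
    fuzzy_min mu (replace i x (f x)) <= mu (tnth x i).

(** (ii) holds as soon as the level sets of mu are closed under solving
    equations. *)
Lemma inequalities_of_closed n (f : n.-tuple G -> G) x0 :
    (forall x, fuzzy_min mu x <= mu (f x)) ->
    (forall (t : R) (H := fun y => t <= mu y) s1 s2 z,
       (size s1 + size s2).+1 = n -> all H s1 -> all H s2 ->
       H (wordop f x0 (s1 ++ z :: s2)) -> H z) ->
  nary_inequalities f.
Proof.
move=> mu_op mu_solve i x; split=> //.
have ltin := ltn_ord i.
have [_] := (le_fuzzy_min mu (replace i x (f x)) _).1 (lexx _).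
rewrite (replace_cat x0) all_cat /= => /and3P[H1 Hfx H2].
apply: (mu_solve _ (take i x) (drop i.+1 x)) => //.
  by rewrite size_takel ?size_drop size_tuple; lia.
rewrite (tnth_nth x0) -drop_nth ?cat_take_drop ?size_tuple //.
by rewrite wordop_tuple.
Qed.

Lemma inequalities_of_subgroup_skew n (f : n.-tuple G -> G)
    (Gf : nary_group f) :
  (2 < n)%N -> fuzzy_subgroup_skew mu Gf -> nary_inequalities f.
Proof.
move=> n_gt2 [mu_op mu_skew]; have [x0] := nary_nonempty Gf.
apply: (@inequalities_of_closed _ _ x0) => // t H s1 s2 z sn Hs1 Hs2.
apply: (solve_closed (Gf := Gf)) => // [s sz Hs|x Hx].
  have szs : size s == n by apply/eqP.
  rewrite (wordop_size _ _ szs); apply: le_trans (mu_op _).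
  apply/le_fuzzy_min; split=> //.
  (* The bound t <= 1 comes from any letter of s. *)
  case: s Hs sz {szs} => [|y s] /=; first by lia.
  by case/andP=> Hy _ _; apply: le_trans Hy _; have /andP[] := hmu y.
exact: le_trans Hx (mu_skew x).
Qed.

Lemma inequalities_of_subgroup2 (f : 2.-tuple G -> G) (Gf : nary_group f) :
  fuzzy_subgroup2 mu Gf -> nary_inequalities f.
Proof.
move=> [mu_op mu_inv]; have [x0] := nary_nonempty Gf.
have opE a b : wordop f x0 [:: a; b] = f [tuple a; b].
  exact: (wordop_tuple f x0 [tuple a; b]).
apply: (@inequalities_of_closed _ _ x0) => [x|t H [|a [|? ?]] [|b [|? ?]] z] //.
- case/tupleP: x => a x; case/tupleP: x => b x; rewrite (tuple0 x).
  have -> : [tuple of a :: [tuple of b :: [tuple]]] = [tuple a; b].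
    exact: val_inj.
  by rewrite fuzzy_min2.
- move=> _ _ /andP[Hb _]; rewrite cat0s opE => Hzb.
  (* z = (z b) b^-1 *)
  rewrite -[z](binary_oneP Gf z).2 -(binary_invP Gf b).2 -binary_assoc //.
  apply: le_trans (mu_op _ _); rewrite le_min [t <= _]Hzb /=.
  exact: le_trans Hb (mu_inv b).
- move=> _ /andP[Ha _] _; rewrite cat1s opE => Haz.
  (* z = a^-1 (a z) *)
  rewrite -[z](binary_oneP Gf z).1 -(binary_invP Gf a).1 binary_assoc //.
  apply: le_trans (mu_op _ _); rewrite le_min [t <= mu (f _)]Haz andbT.
  exact: le_trans Ha (mu_inv a).
Qed.

Lemma subgroup_skew_of_inequalities n (f : n.-tuple G -> G)
    (Gf : nary_group f) :
  nary_inequalities f -> fuzzy_subgroup_skew mu Gf.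
Proof.
move=> mu_ineq; have n_gt1 := nary_arity Gf.
have ltn1 : (n.-1 < n)%N by lia.
split=> x; first by have [] := mu_ineq (Ordinal ltn1) x.
rewrite /Defs.skew; case: cid => z /= [zP _].
have [_] := mu_ineq (Ordinal ltn1) (skew_tuple n x z).
rewrite zP tnth_mktuple /= prednK ?eqxx; last by lia.
apply: le_trans; apply/le_fuzzy_min; split; first by have /andP[] := hmu x.
apply/all_tnthP => j; rewrite !tnth_mktuple -val_eqE /=.
by case: eqP => // j_neq; case: eqP => // j_eq; lia.
Qed.

Lemma subgroup2_of_inequalities (f : 2.-tuple G -> G) (Gf : nary_group f) :
  nary_inequalities f -> fuzzy_subgroup2 mu Gf.
Proof.
move=> mu_ineq; split=> [x y|x].
  by rewrite -fuzzy_min2 //; have [] := mu_ineq ord0 [tuple x; y].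
have mu_r a b : Num.min (mu a) (mu (f [tuple a; b])) <= mu b.
  have [_] := mu_ineq ord_max [tuple a; b].
  have -> : replace ord_max [tuple a; b] (f [tuple a; b])
          = [tuple a; f [tuple a; b]].
    by apply: eq_from_tnth => j; rewrite tnth_mktuple; case: j => [[|[|]]].
  by rewrite fuzzy_min2.
apply: le_trans (mu_r x _); rewrite (binary_invP Gf x).2 le_min lexx /=.
by apply: le_trans (mu_r x _); rewrite (binary_oneP Gf x).2 le_min lexx.
Qed.

End Directions.

Theorem theorem2p8 (R : realType) (n : nat) (G : Type) (f : n.-tuple G -> G)
    (Gf : nary_group f) (mu : G -> R) (hmu : fuzzy_subset mu) :
  fuzzy_nary_subgroup mu Gf <->
  (forall (i : 'I_n) (x : n.-tuple G),
     fuzzy_min mu x <= mu (f x) /\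
     fuzzy_min mu (replace i x (f x)) <= mu (tnth x i)).
Proof.
have n_gt1 := nary_arity Gf.
case: n f Gf n_gt1 => [|[|[|n]]] // f Gf _.
- split; first exact: inequalities_of_subgroup2.
  exact: subgroup2_of_inequalities.
- split; first exact: inequalities_of_subgroup_skew.
  exact: subgroup_skew_of_inequalities.
Qed.
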